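(* Let $X\subset\mathbb{R}^n$ be full-dimensional and compact, and let $F:\mathbb{R}^n\rightarrow\mathbb{R}^n$ be continuous such that $F(X)$ contains the origin. If $F$ is injective over $X$, then \[ \min_{\|\lambda\|=1}\ \max_{x\in X}\ \lambda^T F(x)\ \geq\ \min_{x\in\partial X}\ \max_{\|\lambda\|=1}\ \lambda^T F(x). \]
   Context: Here $\lambda$ ranges over vectors in $\mathbb{R}^n$, $\|\cdot\|$ is the Euclidean norm on $\mathbb{R}^n$, and $\partial X$ is the topological boundary of $X$ in $\mathbb{R}^n$. A compact set $X\subset\mathbb{R}^n$ is full-dimensional if it has dimension $n$; in particular it has nonempty interior. *)

(* Defs.v *)
From HB Require Import structures.
From mathcomp Require Import all_boot all_order all_algebra.
From mathcomp Require Import all_classical all_reals all_analysis.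

Set Implicit Arguments.
Unset Strict Implicit.
Unset Printing Implicit Defensive.

Import Order.TTheory GRing.Theory Num.Theory.
Import numFieldNormedType.Exports.

Local Open Scope classical_set_scope.
Local Open Scope ring_scope.

(* The ambient space R^n is 'rV[R]_n. The norm `|x| that the library puts on
   matrices is the sup norm; it induces the usual topology, but it is not the
   Euclidean norm, which is therefore defined separately. *)

Definition dot (R : realType) (n : nat) (u v : 'rV[R]_n) : R :=
  (u *m v^T) 0 0.

Definition enorm (R : realType) (n : nat) (u : 'rV[R]_n) : R :=
  Num.sqrt (\sum_(i < n) u 0 i ^+ 2).

Definition esphere (R : realType) (n : nat) : set 'rV[R]_n :=
  [set u | enorm u = 1].

Definition boundary (T : topologicalType) (X : set T) : set T :=
  closure X `\` interior X.

(* A subset of R^n is full-dimensional when it is n-dimensional in the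
   topological sense, i.e. has interior points; an affine hull of dimension n
   would not be enough. *)
Definition full_dimensional (R : realType) (n : nat) (X : set 'rV[R]_n) : Prop :=
  interior X !=set0.

Definition is_max (R : realType) (A : set R) (m : R) : Prop :=
  A m /\ ubound A m.

Definition is_min (R : realType) (A : set R) (m : R) : Prop :=
  A m /\ lbound A m.

(* v = min_(s in A) max_(t in B) f s t, where the minimum and all of the inner
   maxima (g s is the one at s) are attained. *)
Definition is_minmax (R : realType) (S T : Type) (A : set S) (B : set T)
    (f : S -> T -> R) (v : R) : Prop :=
  exists g : S -> R,
    (forall s, A s -> is_max (f s @` B) (g s)) /\ is_min (g @` A) v.

(* Main.v *)
Require Import Defs.
From HB Require Import structures.
From mathcomp Require Import all_boot all_order all_algebra.
From mathcomp Require Import all_classical all_reals all_analysis.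
From mathcomp Require Import ring lra.

Set Implicit Arguments.
Unset Strict Implicit.
Unset Printing Implicit Defensive.

Import Order.TTheory GRing.Theory Num.Theory.
Import numFieldNormedType.Exports.

Local Open Scope classical_set_scope.
Local Open Scope ring_scope.

(** Why the inequality holds.  Let r be the minimum of the Euclidean norm of F
    on the boundary of X; by Cauchy-Schwarz this is the right-hand side.  Fix a
    unit vector l.  Among the points of X that F maps to the line spanned by l
    (there is one, since 0 is in F(X)), take one, x, for which l.F(x) is maximal.
    If every l.F were below r on X, then F(x) would have norm below r, so x would
    be interior to X; by invariance of domain F(x) would be interior to F(X), and
    F(X) would contain a point further along the line, against the choice of x.

    The weight is carried by invariance of domain, [interior_image], for an
    injective continuous map on a compact set.  With X compact, F has a
    continuous inverse on F(X).  Suppose that F(x0) is not interior to F(X): some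
    p outside F(X) is very close to it.  Extend a good approximation of the
    inverse to a Lipschitz map G of the whole space
    ([lipschitz_left_inverse]).  Before applying G, push the part of F(X) near p
    radially from p onto a small sphere S about p.  As S has dimension n - 1 and
    G is Lipschitz, G(S) misses points arbitrarily close to x0
    ([lipschitz_sphere_avoid]); a small translation makes it miss x0 itself.  Let
    h(x) be the translate of G at the pushed F(x): it is on G(S) translated, so
    different from x0, when F(x) is near p, and it is close to x otherwise, in
    which case x is not near x0.  Replacing h gradually by the identity as F(x)
    moves away from p gives a continuous map of the whole space, the identity
    outside X, that never takes the value x0.  On a large cube this contradicts
    the Poincare-Miranda theorem ([poincare_miranda]).

    The Poincare-Miranda theorem is reduced to a statement on grids,
    [sign_change_cell].  For 0-1 valued functions a_1, ..., a_n on a grid, the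
    cup product over F_2 of their coboundaries is a sum over monotone lattice
    paths; a cell where it is nonzero is one where every a_i changes value.  It
    is a coboundary, so its total over the box depends only on the boundary
    values, and if a_i is 0 on the face x_i = 0 and 1 on the face x_i = N the
    total is 1, by induction on the dimension. *)

(** * A parity count on integer grids *)

Section GridCochains.
Variable I : eqType.

Implicit Types (x y z : I -> nat) (f : (I -> nat) -> bool) (s : seq I).
Implicit Types (fs : seq ((I -> nat) -> bool)) (k l : I).

Definition step k x : I -> nat := fun i => (x i + (i == k))%N.
Definition set_coord k (t : nat) x : I -> nat := fun i => if i == k then t else x i.
Definition without s k : seq I := [seq l <- s | l != k].

Local Notation "\xor_ ( k <- s ) F" := (\big[addb/false]_(k <- s) F)
  (at level 41, k, s at level 50, F at level 41).
Local Notation "\xor_ ( k < n ) F" := (\big[addb/false]_(k < n) F)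
  (at level 41, k, n at level 50, F at level 41).

(** With as many functions in [fs] as directions in [s], this is the cup product
    over F_2 of the coboundaries of the functions, evaluated on the cube at [x]
    spanned by the directions: a sum over the monotone paths from [x] to the
    opposite corner, whose i-th step contributes the variation of the i-th
    function. *)
Fixpoint path_parity fs s x : bool :=
  if fs is f :: fs' then
    \xor_(k <- s) ((f (step k x) (+) f x) && path_parity fs' (without s k) (step k x))
  else true.

Lemma stepC k l x : step k (step l x) = step l (step k x).
Proof. by apply/funext => i; rewrite /step addnAC. Qed.

Lemma withoutC s k l : without (without s k) l = without (without s l) k.
Proof. by rewrite /without -!filter_predI; apply: eq_filter => i /=; rewrite andbC. Qed.

(** The terms for (k, l) and (l, k) cancel mod 2; this replaces the signs that
    would otherwise be attached to the permutations of the directions. *)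
Lemma xor_offdiag_sym (S : I -> I -> bool) s : (forall k l, S k l = S l k) ->
  \xor_(k <- s) \xor_(l <- without s k) S k l = false.
Proof.
move=> symS; elim: s => [|a s IHs]; first by rewrite big_nil.
rewrite big_cons /without /= eqxx /=.
under [X in _ (+) X]eq_bigr => k _.
  have -> : \big[addb/false]_(l <- (if a != k then a :: [seq l <- s | l != k]
      else [seq l <- s | l != k])) S k l =
      (if k != a then S a k else false) (+) \xor_(l <- without s k) S k l.
    rewrite eq_sym /without; case: ifP => _; last by rewrite addFb.
    by rewrite big_cons symS.
  over.
by rewrite big_split /= IHs addbF big_filter -big_mkcond /= addbb.
Qed.

(** The cup product of coboundaries is a cocycle: its sums over the front faces
    and over the back faces of a cube agree.  Expanding the first variation, the
    value of the first function at the far end of two steps k and l is symmetric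
    in k and l and drops out; the induction hypothesis lets the remaining factor
    slide along one step. *)
Lemma path_parity_closed fs s x :
  \xor_(k <- s) path_parity fs (without s k) (step k x) =
  \xor_(k <- s) path_parity fs (without s k) x.
Proof.
elim: fs s x => [|f fs IHfs] s x //=.
pose P k l y := path_parity fs (without (without s k) l) y.
transitivity (\xor_(k <- s) \xor_(l <- without s k) (f (step k x) && P k l (step k x))).
  transitivity (\xor_(k <- s) \xor_(l <- without s k)
      (f (step l (step k x)) && P k l (step l (step k x))) (+)
    \xor_(k <- s) \xor_(l <- without s k) (f (step k x) && P k l (step l (step k x)))).
    rewrite -big_split /=; apply: eq_bigr => k _.
    by rewrite -big_split /=; apply: eq_bigr => l _; rewrite andb_addl.
  rewrite xor_offdiag_sym ?addFb; last first.
    by move=> k l; rewrite stepC /P withoutC.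
  apply: eq_bigr => k _.
  by rewrite -!big_distrr /= IHfs.
transitivity (\xor_(k <- s) \xor_(l <- without s k) (f (step l x) && P k l (step l x)) (+)
    \xor_(k <- s) \xor_(l <- without s k) (f x && P k l (step l x))); last first.
  rewrite -big_split /=; apply: eq_bigr => k _.
  by rewrite -big_split /=; apply: eq_bigr => l _; rewrite andb_addl.
have -> : \xor_(k <- s) \xor_(l <- without s k) (f x && P k l (step l x)) = false.
  rewrite -[RHS](xor_offdiag_sym (S := fun k l => f x && P k l x) s); last first.
    by move=> k l; rewrite /P withoutC.
  by apply: eq_bigr => k _; rewrite -!big_distrr /= IHfs.
rewrite addbF.
under eq_bigr do rewrite big_filter.
under [RHS]eq_bigr do rewrite big_filter.
rewrite (exchange_big_dep predT) //=.
by apply: eq_bigr => k _; apply: eq_big => [l|l _]; rewrite 1?eq_sym // /P withoutC.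
Qed.

(** The Leibniz rule: as the product of the other coboundaries is closed, the
    whole product is the coboundary of [f] times that product. *)
Lemma path_parity_cons f fs s x :
  path_parity (f :: fs) s x =
  \xor_(k <- s) ((f (step k x) && path_parity fs (without s k) (step k x)) (+)
                 (f x && path_parity fs (without s k) x)).
Proof.
rewrite /= [RHS]big_split /= -[X in _ = _ (+) X]big_distrr /=.
rewrite -path_parity_closed big_distrr -big_split /=.
by apply: eq_bigr => k _; rewrite andb_addl.
Qed.

Variable N : nat.

Fixpoint box_parity s f x : bool :=
  if s is k :: s' then \xor_(t < N) box_parity s' f (set_coord k t x) else f x.

Lemma box_parity_xor (J : Type) (r : seq J) (F : J -> (I -> nat) -> bool) s x :
  box_parity s (fun y => \big[addb/false]_(j <- r) F j y) x =
  \big[addb/false]_(j <- r) box_parity s (F j) x.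
Proof.
elim: s x => [|k s IHs] x //=.
by rewrite exchange_big /=; apply: eq_bigr => t _; rewrite IHs.
Qed.

Lemma eq_box_parity f g s x : f =1 g -> box_parity s f x = box_parity s g x.
Proof. by move=> /funext ->. Qed.

Lemma set_coordC k l t u x : k != l ->
  set_coord k t (set_coord l u x) = set_coord l u (set_coord k t x).
Proof.
move=> kl; apply/funext => i; rewrite /set_coord.
by have [->|//] := eqVneq i k; rewrite (negbTE kl).
Qed.

Lemma box_parity_set_coord f s k t x : k \notin s ->
  box_parity s f (set_coord k t x) = box_parity s (fun y => f (set_coord k t y)) x.
Proof.
elim: s x => [|l s IHs] x //=; rewrite inE negb_or => /andP[kl ks].
by apply: eq_bigr => u _; rewrite set_coordC 1?eq_sym// IHs.
Qed.

Lemma step_set_coord k t x : step k (set_coord k t x) = set_coord k t.+1 x.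
Proof.
apply/funext => i; rewrite /step /set_coord.
by case: eqP => _; rewrite ?addn1 ?addn0.
Qed.

Lemma without_notin s k : k \notin s -> without s k = s.
Proof. by move=> ks; apply/all_filterP/allP => l ls; apply: contraNneq ks => <-. Qed.

(** Stokes' formula in one direction. *)
Lemma box_parity_telescope f s k x : uniq s -> k \in s ->
  box_parity s (fun y => f (step k y) (+) f y) x =
  box_parity (without s k) (fun y => f (set_coord k N y) (+) f (set_coord k 0 y)) x.
Proof.
elim: s x => [|l s IHs] x //= /andP[ls us]; rewrite inE /without /=.
case: (eqVneq k l) => [kl _|kl /= ks]; last first.
  by apply: eq_bigr => t _; rewrite IHs.
rewrite kl /= -/(without s l) without_notin//.
under eq_bigr do rewrite box_parity_set_coord//.
rewrite -box_parity_xor; apply: eq_box_parity => y.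
under eq_bigr do rewrite step_set_coord.
clear IHs; elim: N => [|m IHm]; first by rewrite big_ord0 addbb.
by rewrite big_ord_recr /= IHm addbC -addbA; congr addb; rewrite addbA addbb.
Qed.

(** On a face orthogonal to [k] no path moves in the direction [k], so a function
    that is constant on this face contributes a zero variation. *)
Lemma path_parity_frozen (a : I -> (I -> nat) -> bool) (r : seq I) s x k :
  k \in r -> k \notin s -> (forall y, y k = x k -> a k y = a k x) ->
  path_parity (map a r) s x = false.
Proof.
elim: r s x => [//|l r IHr] s x; rewrite inE => kr ks cst /=.
rewrite big_seq big1// => i si.
have ik : (k == i) = false by apply: contraNF ks => /eqP->.
have stepk : step i x k = x k by rewrite /step ik addn0.
have [<-|kl] := eqVneq k l; first by rewrite (cst _ stepk) addbb.
rewrite (negbTE kl) /= in kr.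
rewrite IHr ?andbF// => [|y]; first by rewrite mem_filter (negbTE ks) andbF.
by rewrite stepk => yx; rewrite !cst.
Qed.

(** By the Leibniz rule and Stokes, the total is a sum over the faces of the box.
    On the faces orthogonal to a direction other than the first one, a constant
    function occurs among the remaining ones and the contribution vanishes; on
    the face where the first coordinate is 0 the first function vanishes; on the
    opposite face it is 1, leaving the same sum in one dimension less. *)
Lemma box_parity_eq1 (a : I -> (I -> nat) -> bool) s x : (0 < N)%N -> uniq s ->
  (forall k y, k \in s -> y k = 0%N -> a k y = false) ->
  (forall k y, k \in s -> y k = N -> a k y = true) ->
  box_parity s (path_parity (map a s) s) x = true.
Proof.
move=> N0; elim: s x => [//|m s IHs] x us a0 aN.
pose h k y := a m y && path_parity (map a s) (without (m :: s) k) y.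
transitivity (\xor_(k <- m :: s)
    box_parity (m :: s) (fun y => h k (step k y) (+) h k y) x).
  rewrite -box_parity_xor; apply: eq_box_parity => y.
  exact: path_parity_cons.
transitivity (\xor_(k <- m :: s) box_parity (without (m :: s) k)
    (fun y => h k (set_coord k N y) (+) h k (set_coord k 0 y)) x).
  by apply: eq_big_seq => k ks; rewrite box_parity_telescope.
have /andP[ms us'] := us.
have box0 r y : box_parity r (fun=> false) y = false.
  by elim: r y => //= i r IHr y; rewrite big1.
have sm : without (m :: s) m = s.
  by rewrite /without /= eqxx /=; exact: without_notin.
rewrite big_cons big_seq big1 ?addbF; last first.
  move=> k ks.
  have vanish y : y k = 0%N \/ y k = N -> h k y = false.
    move=> yk; rewrite /h (@path_parity_frozen _ _ _ _ k) ?andbF//.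
      by rewrite mem_filter eqxx.
    move=> z zk; have ks' : k \in m :: s by rewrite inE ks orbT.
    by case: yk zk => yk; rewrite yk => zk; [rewrite !a0|rewrite !aN].
  rewrite -[RHS](box0 (without (m :: s) k) x); apply: eq_box_parity => y.
  have eqk t : set_coord k t y k = t by rewrite /set_coord eqxx.
  by rewrite (vanish _ (or_intror (eqk N))) (vanish _ (or_introl (eqk 0%N))).
have a0' k y : k \in s -> y k = 0%N -> a k y = false.
  by move=> ks; apply: a0; rewrite inE ks orbT.
have aN' k y : k \in s -> y k = N -> a k y = true.
  by move=> ks; apply: aN; rewrite inE ks orbT.
rewrite sm -[RHS](IHs (set_coord m N x) us' a0' aN').
rewrite box_parity_set_coord//; apply: eq_box_parity => y.
have eqm t : set_coord m t y m = t by rewrite /set_coord eqxx.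
by rewrite /h sm (aN m _ (mem_head _ _) (eqm N)) (a0 m _ (mem_head _ _) (eqm 0%N)) addbF.
Qed.

Lemma xor_exists (J : eqType) (r : seq J) (F : J -> bool) :
  \big[addb/false]_(j <- r) F j -> exists2 j, j \in r & F j.
Proof.
move=> Fr; apply/hasP; apply: contraLR Fr => /hasPn nF.
by rewrite big_seq big1// => j /nF/negbTE.
Qed.

Lemma path_parity_change (a : I -> (I -> nat) -> bool) (r : seq I) s x k :
  path_parity (map a r) s x -> k \in r ->
  exists p q, [/\ a k p != a k q,
    forall i, (x i <= p i <= x i + (i \in s))%N &
    forall i, (x i <= q i <= x i + (i \in s))%N].
Proof.
elim: r s x => [//|l r IHr] s x /= /xor_exists[j js /andP[lj pj]].
have stepj i : (x i <= step j x i <= x i + (i \in s))%N.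
  rewrite /step leq_addr leq_add2l /=.
  by have [->|] := eqVneq i j; rewrite ?js.
rewrite inE; have [-> _|_ /= kr] := eqVneq k l.
  exists (step j x), x; split => //; first by move: lj; case: (a l _); case: (a l _).
  by move=> i; rewrite leqnn leq_addr.
have [p [q [apq px qx]]] := IHr _ _ pj kr.
have widen y : (forall i, (step j x i <= y i <= step j x i + (i \in without s j))%N) ->
    forall i, (x i <= y i <= x i + (i \in s))%N.
  move=> yx i; have /andP[] := yx i; rewrite /step mem_filter.
  have [->|_] /= := eqVneq i j; last by rewrite addn0 => -> ->.
  by rewrite addn0 js => /(leq_trans (leq_addr _ _)) -> ->.
by exists p, q; split => //; exact: widen.
Qed.

Lemma box_parity_exists s f x : uniq s -> box_parity s f x ->
  exists2 y, f y & forall i, i \in s -> (y i < N)%N.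
Proof.
suff H : forall s x, uniq s -> box_parity s f x ->
    exists y, [/\ f y, forall i, i \in s -> (y i < N)%N
      & forall i, i \notin s -> y i = x i].
  by move=> us /(H _ _ us)[y [fy yN _]]; exists y.
elim=> [|k {}s IHs] {}x /=; first by move=> _ fx; exists x.
move=> /andP[ks us] /xor_exists[t _ /(IHs _ us)[y [fy yN yx]]].
exists y; split => // i; rewrite inE ?negb_or.
  have [-> _|_ /yN//] := eqVneq i k.
  by rewrite yx// /set_coord eqxx ltn_ord.
by move=> /andP[ik /yx ->]; rewrite /set_coord (negbTE ik).
Qed.

(** A discrete Poincare-Miranda theorem: a nonzero total forces some cell to have
    a path along which every function varies. *)
Lemma sign_change_cell (a : I -> (I -> nat) -> bool) s : (0 < N)%N -> uniq s ->
  (forall k y, k \in s -> y k = 0%N -> a k y = false) ->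
  (forall k y, k \in s -> y k = N -> a k y = true) ->
  exists2 x : I -> nat, (forall i, i \in s -> (x i < N)%N) &
  forall k, k \in s -> exists p q : I -> nat, [/\ a k p, ~~ a k q,
    forall i, (x i <= p i <= (x i).+1)%N &
    forall i, (x i <= q i <= (x i).+1)%N].
Proof.
move=> N0 us a0 aN.
have /box_parity_exists[//|x /path_parity_change px xN] :=
  box_parity_eq1 (fun=> 0%N) N0 us a0 aN.
exists x => // k /px[p [q [apq xp xq]]].
have cell y : (forall i, (x i <= y i <= x i + (i \in s))%N) ->
    forall i, (x i <= y i <= (x i).+1)%N.
  move=> xy i; have /andP[-> /leq_trans->//] := xy i.
  by rewrite -addn1 leq_add2l leq_b1.
have [ap|ap] := boolP (a k p); have [aq|aq] := boolP (a k q).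
- by rewrite ap aq in apq.
- by exists p, q; split => //; exact: cell.
- by exists q, p; split => //; exact: cell.
- by rewrite (negbTE ap) (negbTE aq) in apq.
Qed.

End GridCochains.

(** * The Poincare-Miranda theorem *)

Lemma closed_sublevel (T : topologicalType) (R : realFieldType) (f : T -> R) (c : R) :
  continuous f -> closed [set x | f x <= c].
Proof.
by move=> cf; apply: (@preimage_closed _ _ f [set y | y <= c]) => [x _|];
  [exact: cf|exact: closed_le].
Qed.

Lemma rV_norm_le (R : realType) n (x : 'rV[R]_n) (e : R) : 0 <= e ->
  (forall i, `|x 0 i| <= e) -> `|x| <= e.
Proof.
move=> e0 xe; rewrite /Num.norm /= mx_normrE; apply/bigmax_leP; split => //.
by move=> [i j] _ /=; rewrite (ord1 i).
Qed.

Lemma rV_coord_le (R : realType) n (x : 'rV[R]_n) i : `|x 0 i| <= `|x|.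
Proof.
by rewrite [leRHS]/Num.norm /= mx_normrE (le_bigmax _ (fun ij => `|x ij.1 ij.2|) (0, i)).
Qed.

Lemma closed_ball_rV_compact (R : realType) n (M : R) :
  compact [set x : 'rV[R]_n | `|x| <= M].
Proof.
apply: bounded_closed_compact.
  by exists M; split; [exact: num_real|move=> y My x /= /le_trans->//; exact: ltW].
by apply: closed_sublevel => x; exact: norm_continuous.
Qed.

Lemma continuous_coord (T : topologicalType) (R : realType) n
    (f : T -> 'rV[R]_n) i : continuous f -> continuous (fun x => f x 0 i).
Proof.
move=> cf x; apply: (@continuous_comp _ _ _ f (fun u : 'rV[R]_n => u 0 i)).
  exact: cf.
exact: coord_continuous.
Qed.

(** If f had no zero, then by compactness every small enough ball centred in the
    cube would carry a coordinate of f of constant strict sign; the cell provided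
    by [sign_change_cell] for the signs of the coordinates of f on a fine grid is
    contained in such a ball and contradicts this. *)
Theorem poincare_miranda (R : realType) n (f : 'rV[R]_n -> 'rV[R]_n) (M : R) :
  0 < M -> continuous f ->
  (forall (x : 'rV[R]_n) i, `|x| <= M -> x 0 i = - M -> f x 0 i <= 0) ->
  (forall (x : 'rV[R]_n) i, `|x| <= M -> x 0 i = M -> 0 <= f x 0 i) ->
  exists2 x, `|x| <= M & f x = 0.
Proof.
move=> M0 cf fle fge; apply: contrapT => /forall2NP nz.
pose flip (d : R) (x : 'rV[R]_n) i := exists y z : 'rV[R]_n,
  [/\ `|x - y| <= d, `|x - z| <= d, f y 0 i <= 0 & 0 <= f z 0 i].
have : \forall d \near 0^'+, forall x, `|x| <= M -> exists i, ~ flip d x i.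
  have /compact_near_coveringP cov := @closed_ball_rV_compact R n M.
  apply: cov => x xM.
  have [//|fx0] := nz x.
  have [i fxi] : exists i, f x 0 i != 0.
    apply: contrapT => /forallNP fx; apply: fx0; apply/rowP => i; rewrite mxE.
    by apply/eqP/negPn/negP; exact: fx.
  have fxi0 : 0 < `|f x 0 i| by rewrite normr_gt0.
  have /cvgrPdist_lt/(_ _ fxi0) := @continuous_coord _ _ _ _ i cf x.
  move=> /nbhs_ballP[e /= e0 xe].
  exists (ball x (e / 2), [set d | d < e / 2]).
    split; first by apply: nbhsx_ballx; exact: divr_gt0.
    by apply: nbhs_right_lt; exact: divr_gt0.
  move=> [x' d] /= []; rewrite -ball_normE /= => xx' de; exists i.
  move=> [y [z [xy xz fy fz]]].
  have near_x u : `|x' - u| <= d -> `|f x 0 i - f u 0 i| < `|f x 0 i|.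
    move=> x'u; apply: xe; rewrite -ball_normE /=.
    rewrite [e]splitr (le_lt_trans (ler_distD x' _ _))// ltrD//.
    exact: le_lt_trans de.
  move/ltr_normlP: (near_x _ xy) (near_x _ xz) => [_ xy1] /ltr_normlP[xz1 _].
  by have [fx|fx] := ltrP (f x 0 i) 0; [move: xz1; rewrite ltr0_norm//|
    move: xy1; rewrite ger0_norm//]; lra.
move=> [e /= e0 /(_ (e / 2))]; rewrite /= sub0r normrN.
have e20 : 0 < e / 2 by exact: divr_gt0.
rewrite gtr0_norm// => /(_ _ e20) fine.
have {fine} : forall x, `|x| <= M -> exists i, ~ flip (e / 2) x i.
  by apply: fine; lra.
set d := e / 2 in e20 * => fine.
have [N N0 Nd] : exists2 N, (0 < N)%N & (2 * M) / N%:R <= d.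
  exists (Num.truncn (2 * M / d)).+1 => //.
  rewrite ler_pdivrMr ?ltr0n// [leRHS]mulrC -ler_pdivrMr//.
  apply: ltW; exact: truncnS_gt.
have NR0 : 0 < N%:R :> R by rewrite ltr0n.
have MN0 : 0 <= 2 * M / N%:R by rewrite divr_ge0 ?mulr_ge0// ltW.
pose pt (y : 'I_n -> nat) : 'rV[R]_n := \row_i (- M + 2 * M / N%:R * (y i)%:R).
have ptE y i : pt y 0 i = - M + 2 * M / N%:R * (y i)%:R by rewrite mxE.
have pt_le y : (forall i, (y i <= N)%N) -> `|pt y| <= M.
  move=> yN; apply: rV_norm_le => [|i]; first exact: ltW.
  rewrite ptE ler_norml.
  have : 2 * M / N%:R * (y i)%:R <= 2 * M.
    rewrite mulrAC ler_pdivrMr// ler_wpM2l// ?ler_nat// mulr_ge0// ltW//.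
  have : 0 <= 2 * M / N%:R * (y i)%:R by rewrite mulr_ge0.
  by move=> ? ?; apply/andP; split; lra.
(* The values on the faces are imposed, so that they hold on all of the grid;
   the weak signs of f on the faces keep them compatible with f. *)
pose a i y := if y i == 0%N then false else
  if (N <= y i)%N then true else 0 < f (pt y) 0 i.
have [||//|//|x xN flips] := @sign_change_cell 'I_n N a (enum 'I_n).
- exact: N0.
- exact: enum_uniq.
- by move=> k y _ yk; rewrite /a yk.
- by move=> k y _ yk; rewrite /a yk leqnn -leqn0 leqNgt N0.
have {}xN i : (x i < N)%N by apply: xN; rewrite mem_enum.
have [|i nflip] := fine (pt x); first by apply: pt_le => i; exact: ltnW.
have [|p [q [ap aq xp xq]]] := flips i; first by rewrite mem_enum.
have cell_le (y : 'I_n -> nat) :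
    (forall i, (x i <= y i <= (x i).+1)%N) -> forall i, (y i <= N)%N.
  by move=> xy j; have /andP[_ /leq_trans->//] := xy j; exact: xN.
have cell_near (y : 'I_n -> nat) :
    (forall i, (x i <= y i <= (x i).+1)%N) -> `|pt x - pt y| <= d.
  move=> xy; apply: (le_trans _ Nd); apply: rV_norm_le => // j.
  rewrite !mxE opprD addrACA subrr add0r -mulrBr normrM (ger0_norm MN0).
  rewrite ler_piMr//.
  have /andP[x1 x2] := xy j.
  by rewrite distrC -natrB// normr_nat (ler_nat _ _ 1) leq_subLR addn1.
apply: nflip; exists (pt q), (pt p); split; try exact: cell_near.
- move: aq; rewrite /a; case: eqP => [qi _|_].
    by apply: fle; [exact/pt_le/cell_le|rewrite ptE qi mulr0 addr0].
  by case: ifP => // _; rewrite -leNgt.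
- move: ap; rewrite /a; case: eqP => // _; case: ifP => [Np _|_]; last exact: ltW.
  apply: fge; first exact/pt_le/cell_le.
  have -> : pt p 0 i = - M + 2 * M / N%:R * N%:R.
    by rewrite ptE; congr (_ + _ * _%:R); apply/eqP; rewrite eqn_leq Np cell_le.
  by rewrite divfK ?gt_eqF//; lra.
Qed.

(** * Lipschitz approximation of the inverse of an injective map *)

(** McShane's inf-convolution.  Here [g] need only be Lipschitz along [phi] up to
    the error [e], and the extension reproduces it up to [e]. *)
Lemma mcshane_approx (R : realType) (T : Type) (V : normedModType R)
    (X : set T) (g : T -> R) (phi : T -> V) (L e b : R) :
  X !=set0 -> 0 <= L -> (forall x, X x -> b <= g x) ->
  (forall x z, X x -> X z -> g x <= g z + e + L * `|phi x - phi z|) ->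
  exists G : V -> R, (forall y z, `|G y - G z| <= L * `|y - z|) /\
    forall x, X x -> `|G (phi x) - g x| <= e.
Proof.
move=> X0 L0 gb gL.
pose E y := [set g z + L * `|y - phi z| | z in X].
have E0 y : E y !=set0 by exact: image_nonempty.
have Eb y : has_lbound (E y).
  exists b => _ [z Xz <-]; apply: (le_trans (gb _ Xz)).
  by rewrite lerDl mulr_ge0.
have GL y z : inf (E y) <= inf (E z) + L * `|y - z|.
  rewrite -lerBlDr; apply: lb_le_inf => // _ [t Xt <-].
  rewrite lerBlDr; apply: (@le_trans _ _ (g t + L * `|y - phi t|)).
    by apply: ge_inf => //; exists t.
  by rewrite -addrA lerD2l -mulrDr ler_wpM2l// [leRHS]addrC ler_distD.
exists (fun y => inf (E y)); split => [y z|x Xx].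
  rewrite ler_distl GL andbT lerBlDr.
  by rewrite distrC; exact: GL.
rewrite ler_distl; apply/andP; split.
  apply: lb_le_inf => // _ [z Xz <-].
  by have := gL _ _ Xx Xz; lra.
rewrite (le_trans (ge_inf (Eb _) (imageP _ Xx)))// subrr normr0 mulr0 addr0.
by have := gL _ _ Xx Xx; rewrite subrr normr0 mulr0; lra.
Qed.

(** Where |x - z| is at least e, injectivity and compactness keep |F x - F z| away
    from 0, so a large multiple of it dominates |x - z|. *)
Lemma compact_injective_modulus (R : realType) n (X : set 'rV[R]_n)
    (F : 'rV[R]_n -> 'rV[R]_n) (e : R) :
  compact X -> continuous F -> {in X &, injective F} -> 0 < e ->
  exists2 L, 0 <= L & forall x z, X x -> X z -> `|x - z| <= e + L * `|F x - F z|.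
Proof.
move=> cX cF iF e0.
pose P : set ('rV[R]_n * 'rV[R]_n) := (X `*` X) `&` [set u | - `|u.1 - u.2| <= - e].
have cd : continuous (fun u : 'rV[R]_n * 'rV[R]_n => `|u.1 - u.2|).
  by move=> u; apply: cvg_norm; apply: cvgB; [exact: cvg_fst|exact: cvg_snd].
have cP : compact P.
  apply: compact_closedI; first exact: compact_setX.
  by apply: closed_sublevel => u; apply: cvgN; exact: cd.
have far u : ~ P u -> X u.1 -> X u.2 -> `|u.1 - u.2| <= e.
  move=> nP Xu1 Xu2; rewrite leNgt; apply/negP => ue; apply: nP; split => //.
  by rewrite /= lerN2 ltW.
have [P0|P0] := pselect (P !=set0); last first.
  exists 0 => // x z Xx Xz; rewrite mul0r addr0.
  by apply: (far (x, z)) => // Pxz; apply: P0; exists (x, z).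
have cFd : continuous (fun u : 'rV[R]_n * 'rV[R]_n => `|F u.1 - F u.2|).
  move=> u; apply: cvg_norm; apply: cvgB.
    by apply: (@continuous_comp _ _ _ fst F); [exact: cvg_fst|exact: cF].
  by apply: (@continuous_comp _ _ _ snd F); [exact: cvg_snd|exact: cF].
have [u0 /set_mem[[Xu1 Xu2] u0e] u0min] := compact_EVT_min P0 cP (continuous_subspaceT cFd).
have [u1 /set_mem[_ u1e] u1max] := compact_EVT_max P0 cP (continuous_subspaceT cd).
have m0 : 0 < `|F u0.1 - F u0.2|.
  rewrite normr_gt0 subr_eq0; apply/eqP => /iF.
  rewrite !inE => /(_ Xu1 Xu2) u12; move: u0e; rewrite /= u12 subrr normr0.
  by lra.
exists (`|u1.1 - u1.2| / `|F u0.1 - F u0.2|) => [|x z Xx Xz]; first exact: divr_ge0.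
have [Pxz|nPxz] := pselect (P (x, z)); last first.
  apply: (le_trans (far (x, z) nPxz Xx Xz)).
  by rewrite lerDl mulr_ge0// divr_ge0.
apply: (le_trans (u1max _ (mem_set Pxz))).
rewrite -[leLHS]add0r lerD//; first exact: ltW.
rewrite mulrAC -mulrA ler_peMr//.
by rewrite ler_pdivlMr// mul1r; exact: (u0min _ (mem_set Pxz)).
Qed.

(** Plays the role of a Tietze extension of the inverse of F, with the Lipschitz
    bound that the dimension argument below requires. *)
Lemma lipschitz_left_inverse (R : realType) n (X : set 'rV[R]_n)
    (F : 'rV[R]_n -> 'rV[R]_n) (e : R) :
  compact X -> X !=set0 -> continuous F -> {in X &, injective F} -> 0 < e ->
  exists L (G : 'rV[R]_n -> 'rV[R]_n), [/\ 0 <= L,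
    forall y z, `|G y - G z| <= L * `|y - z| &
    forall x, X x -> `|G (F x) - x| <= e].
Proof.
move=> cX X0 cF iF e0.
have [L L0 FL] := compact_injective_modulus cX cF iF e0.
have [B [_ XB]] := compact_bounded cX.
have coord i : exists g : 'rV[R]_n -> R, (forall y z, `|g y - g z| <= L * `|y - z|) /\
    forall x, X x -> `|g (F x) - x 0 i| <= e.
  apply: (@mcshane_approx _ _ _ X (fun x : 'rV[R]_n => x 0 i) F L e (- (B + 1))) => //.
  - move=> x /(XB (B + 1)); rewrite ltrDl ltr01 => /(_ isT).
    by move=> /(le_trans (rV_coord_le x i))/ler_normlP[]; lra.
  - move=> x z Xx Xz; rewrite -addrA -lerBlDl.
    apply: (le_trans _ (FL _ _ Xx Xz)); apply: (le_trans (ler_norm _)).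
    by have := rV_coord_le (x - z) i; rewrite !mxE.
have /choice[g gP] := coord.
exists L, (fun y => \row_i g i y); split => // [y z|x Xx].
  apply: rV_norm_le => [|i]; first exact: mulr_ge0.
  by rewrite !mxE; exact: (gP i).1.
apply: rV_norm_le => [|i]; first exact: ltW.
by rewrite !mxE; exact: (gP i).2.
Qed.

(** * Lipschitz images of spheres miss points *)

Lemma rV_norm_attained (R : realType) n (x : 'rV[R]_n) : 0 < `|x| ->
  exists i, `|x 0 i| = `|x|.
Proof.
move=> x0; have [|[j i] xi] := @mx_norm_neq0 R 1 n x; first exact: lt0r_neq0.
by exists i; rewrite [RHS]xi /= (ord1 j).
Qed.

Lemma truncn_eq_dist (R : realType) (u v : R) : 0 <= u -> 0 <= v ->
  Num.truncn u = Num.truncn v -> `|u - v| <= 1.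
Proof.
move=> u0 v0 uv; have /andP[u1 u2] := truncn_itv u0.
have /andP[v1 v2] := truncn_itv v0; rewrite uv in u1 u2.
by rewrite -natr1 in u2 v2; rewrite ler_norml; apply/andP; split; lra.
Qed.

Lemma natr_dist_ge1 (R : realDomainType) (a b : nat) : a != b ->
  1 <= `|a%:R - b%:R| :> R.
Proof.
wlog ab : a b / (a < b)%N => [hw ab|_].
  move: (ab); rewrite neq_ltn => /orP[lt|lt]; first exact: hw.
  by rewrite distrC; apply: hw; rewrite // eq_sym.
by rewrite distrC -natrB 1?ltnW// normr_nat ler1n subn_gt0.
Qed.

(** A sphere of the sup norm is a union of 2n faces of dimension n - 1.  Cut into
    pieces of side 2D/M, it has of the order of M^(n-1) pieces, and two points in
    one piece have images at distance at most 2DL/M.  If the image covered the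
    ball of radius e about q, it would contain T^n points at mutual distance at
    least e/T.  With M a large multiple of T these lie in distinct pieces, which
    are too few when T is large. *)
Lemma lipschitz_sphere_avoid (R : realType) n (p q : 'rV[R]_n)
    (G : 'rV[R]_n -> 'rV[R]_n) (D L e : R) :
  (0 < n)%N -> 0 < D -> 0 <= L -> 0 < e ->
  (forall y z, `|G y - G z| <= L * `|y - z|) ->
  exists2 v, `|v| <= e & forall y, `|y - p| = D -> G y <> q + v.
Proof.
case: n p q G => [//|m] p q G _ D0 L0 e0 GL.
apply: contrapT => /forall2NP hit.
have [a a0 a_gt] : exists2 a, (0 < a)%N & 2 * D * L < e * a%:R.
  exists (Num.truncn (2 * D * L / e)).+1 => //.
  by rewrite [ltRHS]mulrC -ltr_pdivrMr//; exact: truncnS_gt.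
have [T T_gt] : exists T, (2 * m.+1 * (2 * a) ^ m < T)%N by eexists; exact: leqnn.
have T_gt0 : (0 < T)%N by exact: leq_ltn_trans T_gt.
have T0 : 0 < T%:R :> R by rewrite ltr0n.
(* the points q + v k are the T^n points at mutual distance at least e/T *)
pose v (k : {ffun 'I_m.+1 -> 'I_T}) : 'rV[R]_m.+1 := \row_j (e / T%:R * (k j)%:R).
have v_le k : `|v k| <= e.
  apply: rV_norm_le => [|j]; first exact: ltW.
  have keT : 0 <= e / T%:R * (k j)%:R by rewrite mulr_ge0// divr_ge0// ltW.
  rewrite mxE ger0_norm// mulrAC ler_pdivrMr// ler_pM2l// ler_nat.
  exact/ltnW/ltn_ord.
have v_sep k k' : k != k' -> e / T%:R <= `|v k - v k'|.
  move=> kk'; have [j kj] : exists j, k j != k' j.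
    apply: contrapT => /forallNP eqk; move/eqP: kk'; apply; apply/ffunP => j.
    by apply/eqP/negPn/negP; exact: eqk.
  apply: (le_trans _ (rV_coord_le _ j)); rewrite !mxE -mulrBr normrM ger0_norm.
    by rewrite ler_peMr ?natr_dist_ge1// divr_ge0// ltW.
  by rewrite divr_ge0// ltW.
have /choice[y yP] : forall k, exists y, `|y - p| = D /\ G y = q + v k.
  move=> k; apply: contrapT => nhit; have [/(_ (v_le k))//|] := hit (v k).
  by apply => y yD Gy; apply: nhit; exists y.
have /choice[face faceP] : forall k, exists i, `|(y k - p) 0 i| = D.
  move=> k; have [|i yi] := @rV_norm_attained _ _ (y k - p); first by rewrite (yP k).1.
  by exists i; rewrite yi (yP k).1.
pose M := (a * T)%N.
have M_gt0 : (0 < M)%N by rewrite muln_gt0 a0.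
have M0 : 0 < M%:R :> R by rewrite ltr0n.
pose c k j : R := ((y k - p) 0 j + D) * (M%:R / (2 * D)).
have D2 : 0 < 2 * D by lra.
have MD : 0 <= M%:R / (2 * D) by rewrite divr_ge0// ltW.
have c_itv k j : 0 <= c k j <= M%:R.
  have : `|(y k - p) 0 j| <= D by rewrite -[leRHS](yP k).1; exact: rV_coord_le.
  rewrite ler_norml => /andP[yl yr].
  rewrite /c mulr_ge0//=; last by lra.
  by rewrite mulrCA ler_piMr ?(ltW M0)// ler_pdivrMr// mul1r; lra.
have c_ge0 k j : 0 <= c k j by have /andP[] := c_itv k j.
have c_trunc k j : (Num.truncn (c k j) < M.+1)%N.
  by have /andP[_ /le_truncn] := c_itv k j; rewrite natrK.
(* the piece of the sphere that contains y k: the coordinate and the sign that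
   determine the face, and the position within the face *)
pose key k := (face k, 0 <= (y k - p) 0 (face k),
  [ffun j : 'I_m => inord (Num.truncn (c k (lift (face k) j))) : 'I_M.+1]).
have key_near k k' : key k = key k' -> `|y k - y k'| <= 2 * D / M%:R.
  move=> [eqf eqs eqc]; apply: rV_norm_le => [|j].
    by rewrite divr_ge0// ltW.
  have -> : (y k - y k') 0 j = (y k - p) 0 j - (y k' - p) 0 j.
    by rewrite !mxE; lra.
  case: (unliftP (face k) j) => [j'|] ->.
    have /(congr1 val) := congr1 (fun h : {ffun 'I_m -> 'I_M.+1} => h j') eqc.
    rewrite /= !ffunE -eqf !inordK ?c_trunc// => ceq.
    have := truncn_eq_dist (c_ge0 _ _) (c_ge0 _ _) ceq.
    rewrite -mulrBl opprD addrACA subrr addr0 normrM (ger0_norm MD).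
    by rewrite -ler_pdivlMr ?divr_gt0// mul1r invf_div.
  move: (faceP k) (faceP k') eqs; rewrite -eqf.
  set z := (_ - p) 0 _; set z' := (_ - p) 0 _ => zD z'D zz'.
  suff -> : z = z' by rewrite subrr normr0 divr_ge0// ltW.
  move: zD z'D; have [z0|z0] := lerP 0 z; rewrite ?(ger0_norm z0) ?(ltr0_norm z0).
    by have z'0 : 0 <= z' by [rewrite -zz']; rewrite (ger0_norm z'0) => -> ->.
  have z'0 : z' < 0 by rewrite ltNge -zz' -ltNge.
  by rewrite (ltr0_norm z'0) => <- /oppr_inj.
have : injective key.
  move=> k k' /key_near near; apply/eqP/negPn/negP => /v_sep.
  have -> : v k - v k' = G (y k) - G (y k').
    by rewrite !(yP _).2 opprD addrACA subrr add0r.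
  apply/negP; rewrite -ltNge; apply: (le_lt_trans (GL _ _)).
  apply: (le_lt_trans (ler_wpM2l L0 near)).
  have -> : L * (2 * D / M%:R) = 2 * D * L / a%:R / T%:R.
    by rewrite natrM; field; rewrite !gt_eqF// ltr0n.
  by rewrite ltr_pM2r ?invr_gt0// ltr_pdivrMr// ltr0n.
move=> /leq_card; rewrite !card_prod !card_ffun !card_ord card_bool.
apply/negP; rewrite -ltnNge.
have M_le : (M.+1 <= 2 * a * T)%N.
  by rewrite -mulnA -/M mul2n -addnn -addn1 leq_add2l.
apply: (@leq_ltn_trans (m.+1 * 2 * (2 * a * T) ^ m)%N).
  by rewrite leq_mul2l; have [->|m0] := posnP m; rewrite ?expn0 ?leq_exp2r ?M_le ?orbT.
by rewrite expnMn mulnA expnS ltn_pmul2r ?expn_gt0 ?T_gt0// (mulnC m.+1).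
Qed.

(** * Invariance of domain *)

Lemma lipschitz_continuous (R : realType) (V W : normedModType R) (f : V -> W)
    (L : R) : 0 <= L -> (forall x y, `|f x - f y| <= L * `|x - y|) -> continuous f.
Proof.
move=> L0 fL x; apply/cvgrPdist_le => e e0.
have : \forall y \near x, `|x - y| <= e / (L + 1).
  by apply: cvgr_dist_le; [exact: cvg_id|rewrite divr_gt0// ltr_wpDl].
apply: filterS => y xy; apply: (le_trans (fL _ _)).
rewrite (le_trans (ler_wpM2l L0 xy))// mulrCA ler_piMr ?(ltW e0)//.
by rewrite ler_pdivrMr ?mul1r ?lerDl// ltr_wpDl.
Qed.

Lemma subC_continuous (R : realType) (V : normedModType R) (p : V) :
  continuous (fun z => z - p).
Proof.
by move=> y; apply: (@cvgB _ _ _ _ _ id (fun=> p)); [exact: cvg_id|exact: cvg_cst].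
Qed.

Lemma dist_continuous (R : realType) (T : topologicalType) (V : normedModType R)
    (F : T -> V) (p : V) : continuous F -> continuous (fun x => `|F x - p|).
Proof.
move=> cF x; apply: cvg_norm.
by apply: (@cvgB _ _ _ _ _ F (fun=> p)); [exact: cF|exact: cvg_cst].
Qed.

Lemma blend_continuous (R : realType) (V : normedModType R) (phi : V -> R)
    (H : V -> V) (x0 v : V) : continuous phi -> continuous H ->
  continuous (fun x => (x - x0) + phi x *: (H x - v - x)).
Proof.
move=> cphi cH x; apply: cvgD.
  by apply: cvgB; [exact: cvg_id|exact: cvg_cst].
apply: cvgZ; first exact: cphi.
apply: cvgB; last exact: cvg_id.
by apply: cvgB; [exact: cH|exact: cvg_cst].
Qed.

(** Pushes the ball of radius D about p radially onto its boundary sphere and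
    fixes the rest.  The lower bound d on the distance to p only serves to have
    a map that is continuous everywhere, p included. *)
Definition radial_push (R : realType) (V : normedModType R) (p : V) (D d : R) (y : V) :=
  p + Num.max 1 (D / Num.max d `|y - p|) *: (y - p).

Lemma radial_push_continuous (R : realType) (V : normedModType R) (p : V) (D d : R) : 0 < d ->
  continuous (radial_push p D d).
Proof.
move=> d0 y; have cd := @subC_continuous R V p y.
rewrite /radial_push.
apply: (@cvgD _ _ _ _ _ (fun=> p) (fun z => Num.max 1 (D / Num.max d `|z - p|) *: (z - p))).
  exact: cvg_cst.
apply: (@cvgZ _ _ _ _ _ (fun z => Num.max 1 (D / Num.max d `|z - p|)) (fun z => z - p)) => //.
apply: (@continuous_max R _ (fun=> 1) (fun z => D / Num.max d `|z - p|)).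
  exact: cvg_cst.
apply: (@cvgM _ _ _ _ (fun=> D) (fun z => (Num.max d `|z - p|)^-1)).
  exact: cvg_cst.
apply: (@cvgV _ _ _ _ (fun z => Num.max d `|z - p|)).
  by rewrite gt_eqF// lt_max d0.
apply: (@continuous_max R _ (fun=> d) (fun z => `|z - p|)).
  exact: cvg_cst.
exact: cvg_norm.
Qed.

Lemma radial_push_out (R : realType) (V : normedModType R) (p y : V) (D d : R) :
  0 < D -> d <= `|y - p| -> D <= `|y - p| -> radial_push p D d y = y.
Proof.
move=> D0 dy Dy; have t0 := lt_le_trans D0 Dy.
have le1 : D / `|y - p| <= 1 by rewrite ler_pdivrMr// mul1r.
by rewrite /radial_push (max_r dy) (max_l le1) scale1r addrC subrK.
Qed.

Lemma radial_push_in (R : realType) (V : normedModType R) (p y : V) (D d : R) :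
  0 < d -> d <= `|y - p| -> `|y - p| <= D -> `|radial_push p D d y - p| = D.
Proof.
move=> d0 dy yD; have y0 : 0 < `|y - p| by exact: lt_le_trans dy.
have ge1 : 1 <= D / `|y - p| by rewrite ler_pdivlMr// mul1r.
rewrite /radial_push (max_r dy) (max_r ge1) addrC addKr normrZ.
by rewrite ger0_norm ?(le_trans ler01)// divfK// gt_eqF.
Qed.

Definition cutoff (R : realType) (D t : R) : R := Num.min 1 (Num.max 0 (2 - t / D)).

Lemma cutoff_continuous (R : realType) (D : R) : continuous (cutoff D).
Proof.
move=> t; have ct : (fun u : R => 2 - u / D) @ t --> 2 - t / D.
  apply: cvgB; first exact: cvg_cst.
  by apply: cvgM; [exact: cvg_id|exact: cvg_cst].
have c0 : (fun=> 0 : R) @ t --> (0 : R) by exact: cvg_cst.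
have c1 : (fun=> 1 : R) @ t --> (1 : R) by exact: cvg_cst.
exact: (continuous_min c1 (continuous_max c0 ct)).
Qed.

Lemma cutoff_itv (R : realType) (D t : R) : 0 <= cutoff D t <= 1.
Proof. by rewrite /cutoff le_min ler01 le_max lexx /= ge_min lexx. Qed.

Lemma cutoff_out (R : realType) (D t : R) : 0 < D -> 2 * D <= t -> cutoff D t = 0.
Proof.
move=> D0 Dt; have le0 : 2 - t / D <= 0 by rewrite subr_le0 ler_pdivlMr.
by rewrite /cutoff (max_l le0) min_r.
Qed.

Lemma cutoff_in (R : realType) (D t : R) : 0 < D -> t <= D -> cutoff D t = 1.
Proof.
move=> D0 tD; rewrite /cutoff min_l// le_max; apply/orP; right.
have : t / D <= 1 by rewrite ler_pdivrMr ?mul1r.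
by lra.
Qed.

Lemma boundary_closed (T : topologicalType) (X : set T) : closed (boundary X).
Proof.
rewrite /boundary setDE; apply: closedI; first exact: closed_closure.
by apply: open_closedC; exact: open_interior.
Qed.

Lemma rV_hausdorff (R : realType) n : hausdorff_space 'rV[R]_n.
Proof. exact: norm_hausdorff. Qed.

Lemma boundary_subset (R : realType) n (X : set 'rV[R]_n) : compact X ->
  boundary X `<=` X.
Proof.
move=> cX x [+ _]; rewrite -(iffLR (closure_id X))//.
by apply: compact_closed => //; exact: rV_hausdorff.
Qed.

Lemma boundary_compact (R : realType) n (X : set 'rV[R]_n) : compact X ->
  compact (boundary X).
Proof.
move=> cX; apply: (subclosed_compact _ cX); first exact: boundary_closed.
exact: boundary_subset.
Qed.

Lemma compact_avoid_ball (R : realType) n (K : set 'rV[R]_n) (y : 'rV[R]_n) :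
  compact K -> ~ K y -> exists2 e, 0 < e & forall z, K z -> e <= `|z - y|.
Proof.
move=> cK Ky; have /closed_openC oK := compact_closed (@rV_hausdorff _ _) cK.
have /nbhs_ballP[e /= e0 ye] : nbhs y (~` K) by exact: open_nbhs_nbhs.
exists e => // z Kz; rewrite leNgt; apply/negP => zy; apply: (ye z) => //.
by rewrite -ball_normE /= distrC.
Qed.

Lemma near_lt (T : topologicalType) (R : realType) (f : T -> R) (x : T) (c : R) :
  continuous f -> f x < c -> \forall z \near x, f z < c.
Proof. by move=> cf fx; apply: (cvgr_lt (f x)) => //; exact: cf. Qed.

Lemma near_gt (T : topologicalType) (R : realType) (f : T -> R) (x : T) (c : R) :
  continuous f -> c < f x -> \forall z \near x, c < f z.
Proof. by move=> cf fx; apply: (cvgr_gt (f x)) => //; exact: cf. Qed.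

Lemma near_eq_continuous (T U : topologicalType) (f g : T -> U) (x : T) :
  (\forall z \near x, g z = f z) -> {for x, continuous g} -> {for x, continuous f}.
Proof.
move=> gf cg; have fx : g x = f x := nbhs_singleton gf.
suff : f @ x --> g x by rewrite fx.
by apply: cvg_trans cg; exact: near_eq_cvg.
Qed.

(** Vanishing near each boundary point, rather than only on the boundary, makes
    the extension locally equal to [g] or to 0 everywhere. *)
Lemma extend_by_zero_continuous (T : topologicalType) (R : realType) (X : set T)
    (g : T -> R) : closed X -> continuous g ->
  (forall x, boundary X x -> \forall z \near x, g z = 0) ->
  continuous (fun x => if x \in X then g x else 0).
Proof.
move=> clX cg g0 x; have [Xx|nXx] := pselect (X° x).
  apply: (@near_eq_continuous _ _ _ g); last exact: cg.
  by apply: filterS Xx => z Xz; rewrite mem_set.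
apply: (@near_eq_continuous _ _ _ (fun=> 0)); last exact: cvg_cst.
have [Xx|Xx] := pselect (X x).
  have : boundary X x by split => //; exact: subset_closure.
  by move=> /g0; apply: filterS => z ->; rewrite if_same.
have : nbhs x (~` X) by apply: open_nbhs_nbhs; split => //; exact: closed_openC.
by apply: filterS => z Xz; rewrite memNset.
Qed.

(** The map [f] below is x - x0 outside X.  On X, where F x is within D of p, the
    factor [phi] is 1 and f x is the translate of G at a point of the sphere,
    minus x0, hence nonzero; where F x is further away, [G (Phi (F x)) - v] is
    closer to x than x0 is, and no convex combination of it with x equals x0. *)
Theorem interior_image (R : realType) n (X : set 'rV[R]_n)
    (F : 'rV[R]_n -> 'rV[R]_n) (x0 : 'rV[R]_n) :
  (0 < n)%N -> compact X -> continuous F -> {in X &, injective F} ->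
  X° x0 -> (F @` X)° (F x0).
Proof.
move=> n0 cX cF iF Xx0; apply: contrapT => nint.
have Xx0' : X x0 by exact: interior_subset.
have clX : closed X by apply: compact_closed => //; exact: rV_hausdorff.
have [D D0 bdD] : exists2 D, 0 < D & forall x, boundary X x -> 3 * D <= `|F x - F x0|.
  have [||e e0 Ke] := @compact_avoid_ball R n (F @` boundary X) (F x0).
  - apply: continuous_compact; last exact: boundary_compact.
    exact: continuous_subspaceT.
  - move=> [x bx /iF]; rewrite !inE => /(_ (boundary_subset cX bx) Xx0') xx0.
    by case: bx => _; rewrite xx0.
  exists (e / 3); first exact: divr_gt0.
  by move=> x bx; rewrite mulrC divfK//; apply: Ke; exists x.
(* F x0 is not interior to F(X), so p exists; its distance to F(boundary X) is
   still more than 2 D *)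
have [p pD Kp] : exists2 p, `|F x0 - p| < D & ~ (F @` X) p.
  apply: contrapT => /forall2NP np; apply: nint.
  apply/nbhs_ballP; exists D => //= p; rewrite -ball_normE /= => pD.
  by have [//|/contrapT] := np p.
have [d d0 Kd] : exists2 d, 0 < d & forall x, X x -> d <= `|F x - p|.
  have [|e e0 Ke] := @compact_avoid_ball R n (F @` X) p _ Kp.
    by apply: continuous_compact => //; exact: continuous_subspaceT.
  by exists e => // x Xx; apply: Ke; exists x.
pose r x := `|F x - p|.
have cr : continuous r by exact: dist_continuous.
have [eta eta0 etaP] : exists2 eta, 0 < eta & forall x, D <= r x -> eta <= `|x - x0|.
  have : \forall x \near x0, r x < D by exact: near_lt.
  move=> /nbhs_ballP[e /= e0 xe]; exists e => // x; apply: contraTT.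
  by rewrite -!ltNge => xx0; apply: xe; rewrite -ball_normE /= distrC.
have e4 : 0 < eta / 4 by exact: divr_gt0.
have [L [G [L0 GL GF]]] := lipschitz_left_inverse cX (ex_intro _ _ Xx0') cF iF e4.
have [v v_le vG] := lipschitz_sphere_avoid p x0 n0 D0 L0 e4 GL.
pose psi := cutoff D; have cpsi : continuous psi by exact: cutoff_continuous.
(* psi vanishes from 2 D on, so psi (r x) = 0 near the boundary of X *)
pose phi x := if x \in X then psi (r x) else 0.
have cphi : continuous phi.
  apply: (@extend_by_zero_continuous _ _ _ (fun x => psi (r x))) => // [x|x bx].
    by apply: continuous_comp; [exact: cr|exact: cpsi].
  have rx : 2 * D < r x.
    have := bdD x bx; have := ler_distD p (F x) (F x0).
    by rewrite (distrC p) -/(r x); lra.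
  have : \forall z \near x, 2 * D < r z by exact: near_gt.
  by apply: filterS => z rz; rewrite /psi cutoff_out// ltW.
pose Phi := radial_push p D d.
pose f (x : 'rV[R]_n) : 'rV[R]_n := (x - x0) + phi x *: (G (Phi (F x)) - v - x).
have cG : continuous G by exact: (lipschitz_continuous L0).
have cPhi : continuous Phi by exact: radial_push_continuous.
have cf : continuous f.
  apply: (@blend_continuous _ _ phi (fun x => G (Phi (F x)))) => // x.
  apply: (@continuous_comp _ _ _ F (fun y => G (Phi y))); first exact: cF.
  by apply: (@continuous_comp _ _ _ Phi G); [exact: cPhi|exact: cG].
have [B [_ XB]] := compact_bounded cX.
pose M := `|B| + 1.
have M0 : 0 < M by rewrite ltr_wpDl.
have XM x : X x -> `|x| < M.
  have BM : B < `|B| + 2^-1 by have := ler_norm B; lra.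
  by move=> /(XB _ BM)/= xB; apply: (le_lt_trans xB); rewrite /M; lra.
have f_face (x : 'rV[R]_n) i : `|x 0 i| = M -> f x 0 i = x 0 i - x0 0 i.
  move=> xM; have nXx : ~ X x.
    by move=> /XM; rewrite ltNge -xM rV_coord_le.
  by rewrite /f /phi memNset// scale0r addr0 !mxE.
have x0i i : `|x0 0 i| < M by apply: le_lt_trans (XM _ Xx0'); exact: rV_coord_le.
have [||x _ fx0] := @poincare_miranda R n f M M0 cf.
- move=> x i _ xi; rewrite f_face; last by rewrite xi normrN gtr0_norm.
  by have := x0i i; rewrite xi => /ltr_normlP[]; lra.
- move=> x i _ xi; rewrite f_face; last by rewrite xi gtr0_norm.
  by have := x0i i; rewrite xi => /ltr_normlP[]; lra.
have [Xx|nXx] := pselect (X x); last first.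
  apply: (nXx); move: fx0; rewrite /f /phi memNset// scale0r addr0 => /subr0_eq ->.
  exact: Xx0'.
move: fx0; rewrite /f /phi mem_set//; have dx := Kd x Xx.
have [rD|rD] := lerP (r x) D.
  rewrite /psi cutoff_in// scale1r.
  have -> : x - x0 + (G (Phi (F x)) - v - x) = G (Phi (F x)) - (x0 + v).
    by apply/rowP => i; rewrite !mxE; ring.
  by move=> /subr0_eq; apply: vG; exact: radial_push_in.
have /etaP xx0 := ltW rD; rewrite /Phi radial_push_out ?(ltW rD)//.
move=> /eqP; rewrite addr_eq0 => /eqP xx0E.
have /andP[ps0 ps1] := cutoff_itv D (r x).
have : `|x - x0| <= eta / 4 + eta / 4.
  rewrite xx0E normrN normrZ ger0_norm// addrAC -[leRHS]mul1r ler_pM//.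
  by apply: (le_trans (ler_normB _ _)); rewrite lerD//; exact: GF.
by lra.
Qed.

(** * The Euclidean scalar product and the unit sphere *)

Section Dot.
Variables (R : realType) (n : nat).
Implicit Types u v w : 'rV[R]_n.

Lemma dotE u v : dot u v = \sum_i u 0 i * v 0 i.
Proof. by rewrite /dot mxE; apply: eq_bigr => i _; rewrite mxE. Qed.

Lemma dotC u v : dot u v = dot v u.
Proof. by rewrite !dotE; apply: eq_bigr => i _; rewrite mulrC. Qed.

Lemma dotDl u v w : dot (u + v) w = dot u w + dot v w.
Proof. by rewrite /dot mulmxDl mxE. Qed.

Lemma dotZl (a : R) u v : dot (a *: u) v = a * dot u v.
Proof. by rewrite /dot -scalemxAl mxE. Qed.

Lemma dotDr u v w : dot u (v + w) = dot u v + dot u w.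
Proof. by rewrite !(dotC u) dotDl. Qed.

Lemma dotZr (a : R) u v : dot u (a *: v) = a * dot u v.
Proof. by rewrite !(dotC u) dotZl. Qed.

Lemma dot0r u : dot u 0 = 0.
Proof. by rewrite /dot trmx0 mulmx0 mxE. Qed.

Lemma dot_ge0 u : 0 <= dot u u.
Proof. by rewrite dotE sumr_ge0// => i _; rewrite -expr2 sqr_ge0. Qed.

Lemma enormE u : enorm u = Num.sqrt (dot u u).
Proof. by rewrite /enorm dotE; congr Num.sqrt; apply: eq_bigr => i _; rewrite expr2. Qed.

Lemma sqr_enorm u : enorm u ^+ 2 = dot u u.
Proof. by rewrite enormE sqr_sqrtr// dot_ge0. Qed.

Lemma enorm_ge0 u : 0 <= enorm u.
Proof. exact: sqrtr_ge0. Qed.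

Lemma esphereP u : @esphere R n u <-> dot u u = 1.
Proof.
rewrite /esphere /= -sqr_enorm; split=> [->|/eqP]; first by rewrite expr1n.
by rewrite sqrp_eq1 ?enorm_ge0// => /eqP.
Qed.

Lemma enormZ_ge0 (a : R) u : @esphere R n u -> 0 <= a -> enorm (a *: u) = a.
Proof.
move=> /esphereP u1 a0; rewrite enormE dotZl dotZr u1 mulr1 -expr2.
by rewrite sqrtr_sqr ger0_norm.
Qed.

(** Expand the square of the norm of |v| u - v, or of (u.v) u - v when |v| = 0. *)
Lemma cauchy_schwarz_unit u v : @esphere R n u -> dot u v <= enorm v.
Proof.
move=> /esphereP u1; have := enorm_ge0 v; rewrite le_eqVlt => /orP[/eqP v0|v0].
  have := dot_ge0 (dot u v *: u + (-1) *: v).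
  rewrite !(dotDl, dotDr, dotZl, dotZr) u1 -(sqr_enorm v) -v0 (dotC v).
  by rewrite leNgt => h; apply/negP => uv; nra.
have := dot_ge0 (enorm v *: u + (-1) *: v).
rewrite !(dotDl, dotDr, dotZl, dotZr) u1 -(sqr_enorm v) (dotC v) => h.
by rewrite -(ler_pM2l v0); nra.
Qed.

Lemma dot_continuous (T : topologicalType) (a b : T -> 'rV[R]_n) :
  continuous a -> continuous b -> continuous (fun x => dot (a x) (b x)).
Proof.
move=> ca cb; have -> : (fun x => dot (a x) (b x)) =
    (fun x => \sum_i a x 0 i * b x 0 i) by apply/funext => y; rewrite dotE.
apply: continuous_big; first exact: add_continuous.
by move=> i _ x; apply: cvgM; exact: continuous_coord.
Qed.

Lemma esphere_compact : compact (@esphere R n).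
Proof.
apply: (subclosed_compact _ (@closed_ball_rV_compact R n 1)).
  have -> : @esphere R n = [set u | `|dot u u - 1| <= 0].
    apply/seteqP; split => u /=; rewrite normr_le0 subr_eq0.
      by move=> /esphereP ->.
    by move=> /eqP/esphereP.
  apply: closed_sublevel; apply: dist_continuous.
  by apply: dot_continuous => x; exact: cvg_id.
move=> u /esphereP u1; apply: rV_norm_le => // i.
rewrite -(@ler_pXn2r _ 2) ?nnegrE// expr1n -u1 dotE real_normK ?num_real//.
by rewrite (bigD1 i)//= -expr2 lerDl sumr_ge0// => j _; rewrite -expr2 sqr_ge0.
Qed.

Lemma esphere_nonempty : (0 < n)%N -> @esphere R n !=set0.
Proof.
move=> n0; exists (delta_mx 0 (Ordinal n0)); apply/esphereP.
rewrite dotE (bigD1 (Ordinal n0))//= big1 ?addr0 ?mxE ?eqxx ?mulr1// => i ni.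
by rewrite mxE (negbTE ni) mulr0.
Qed.

End Dot.

(** * The minimax inequality *)

(** The inner maximum is a supremum of continuous functions of [s], hence lower
    semicontinuous: if its infimum v were not attained, it would exceed some v + c
    with c > 0 near each point, and by compactness on all of A. *)
Lemma minmax_exists (R : realType) (S T : topologicalType) (A : set S) (B : set T)
    (f : S -> T -> R) :
  A !=set0 -> compact A -> B !=set0 -> compact B ->
  (forall s, continuous (f s)) -> (forall t, continuous (f^~ t)) ->
  exists v, is_minmax A B f v.
Proof.
move=> A0 cA B0 cB cfs cft.
have /choice[g gP] : forall s, exists m, is_max (f s @` B) m.
  move=> s; have [t /set_mem Bt tmax] := compact_EVT_max B0 cB (continuous_subspaceT (cfs s)).
  exists (f s t); split; first by exists t.
  by move=> _ [t' Bt' <-]; apply: tmax; exact: mem_set.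
have fg s t : B t -> f s t <= g s by move=> Bt; apply: (gP s).2; exists t.
have [v [gv vg]] : exists v, is_min (g @` A) v; last by exists v, g.
apply: contrapT => nmin.
have [t0 Bt0] := B0.
have lb : has_lbound (g @` A).
  have [s /set_mem As smin] := compact_EVT_min A0 cA (continuous_subspaceT (cft t0)).
  exists (f s t0) => _ [s' As' <-]; apply: (le_trans _ (fg _ _ Bt0)).
  by apply: smin; exact: mem_set.
have gA0 : g @` A !=set0 by exact: image_nonempty.
pose v := inf (g @` A).
have vg s : A s -> v < g s.
  move=> As; have vs_le : v <= g s by apply: ge_inf => //; exists s.
  rewrite lt_neqAle vs_le andbT; apply/eqP => vs; apply: nmin; exists v; split; first by exists s.
  by move=> _ [s' As' <-]; apply: ge_inf => //; exists s'.
have : \forall c \near 0^'+, forall s, A s -> v + c <= g s.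
  have /compact_near_coveringP cov := cA.
  apply: cov => s As; have := vg s As.
  have [[t Bt <-] _] := gP s; move=> vfs.
  pose e := (f s t - v) / 2.
  have e0 : 0 < e by rewrite divr_gt0// subr_gt0.
  exists ([set s' | v + e < f s' t], [set c | c < e]).
    split; last exact: nbhs_right_lt.
    by apply: near_gt; [exact: cft|rewrite /e; lra].
  move=> [s' c] /= [s't ce]; apply: (le_trans _ (fg _ _ Bt)).
  by apply: ltW; apply: lt_trans s't; rewrite ltrD2l.
move=> [e /= e0 /(_ (e / 2))]; rewrite /= sub0r normrN.
have e20 : 0 < e / 2 by exact: divr_gt0.
rewrite gtr0_norm// ltr_pdivrMr// ltr_pMr// ltr1n => /(_ isT e20) h.
have : v + e / 2 <= v by apply: lb_le_inf => // _ [s As <-]; exact: h.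
by rewrite gerDl leNgt e20.
Qed.

(** A point of X with the largest possible first coordinate is not interior. *)
Lemma boundary_nonempty (R : realType) n (X : set 'rV[R]_n) :
  (0 < n)%N -> X !=set0 -> compact X -> boundary X !=set0.
Proof.
move=> n0 X0 cX; pose i := Ordinal n0.
have ci : continuous (fun x : 'rV[R]_n => x 0 i) by exact: coord_continuous.
have [x /set_mem Xx xmax] := compact_EVT_max X0 cX (continuous_subspaceT ci).
exists x; split; first exact: subset_closure.
move=> /nbhs_ballP[e /= e0 xe].
have : X (x + (e / 2) *: delta_mx 0 i).
  apply: xe; rewrite -ball_normE /= opprD addNKr normrN.
  apply: (@le_lt_trans _ _ (e / 2)); last by lra.
  have e20 : 0 <= e / 2 by lra.
  apply: rV_norm_le => // j; rewrite !mxE eqxx /= normrM (ger0_norm e20) ler_piMr//.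
  by case: (j == i); rewrite ?normr1 ?normr0.
move=> /mem_set/xmax; rewrite !mxE !eqxx mulr1.
by lra.
Qed.

Lemma dist_to_line_continuous (R : realType) (T : topologicalType)
    (V : normedModType R) (a : T -> V) (b : T -> R) (l : V) :
  continuous a -> continuous b -> continuous (fun x => `|a x - b x *: l|).
Proof.
move=> ca cb x; apply: cvg_norm; apply: cvgB; first exact: ca.
by apply: cvgZ; [exact: cb|exact: cvg_cst].
Qed.

Theorem theorem3p3 (R : realType) (n : nat) (n_gt0 : (0 < n)%N)
    (X : set 'rV[R]_n) (F : 'rV[R]_n -> 'rV[R]_n)
    (X_full : full_dimensional X) (X_compact : compact X)
    (F_cont : continuous F) (F_zero : (F @` X) 0)
    (F_inj : {in X &, injective F}) :
  exists lhs rhs : R,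
    [/\ is_minmax (@esphere R n) X (fun l x => dot l (F x)) lhs,
        is_minmax (boundary X) (@esphere R n) (fun x l => dot l (F x)) rhs
      & lhs >= rhs].
Proof.
have [z Xz Fz] := F_zero; have X0 : X !=set0 by exists z.
have cl l : continuous (fun x => dot l (F x)).
  by apply: dot_continuous => //; exact: cst_continuous.
have cx x : continuous (fun l => dot l (F x)).
  apply: dot_continuous; first by move=> l; exact: cvg_id.
  exact: cst_continuous.
have sph0 := esphere_nonempty R n_gt0.
have csph := @esphere_compact R n.
have [lhs lhsP] := minmax_exists sph0 csph X0 X_compact cl cx.
have [rhs rhsP] := minmax_exists (boundary_nonempty n_gt0 X0 X_compact)
  (boundary_compact X_compact) sph0 csph cx cl.
exists lhs, rhs; split => //.
have rhs_le x : boundary X x -> rhs <= enorm (F x).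
  move=> bx; have [g [gmax [_ gmin]]] := rhsP.
  have [[l sl gx] _] := gmax x bx.
  apply: (@le_trans _ _ (g x)); first by apply: gmin; exists x.
  by rewrite -gx; exact: cauchy_schwarz_unit.
have [g [gmax [[l sl gl] _]]] := lhsP.
have lhs_ge x : X x -> dot l (F x) <= lhs.
  by move=> Xx; rewrite -gl; apply: (gmax l sl).2; exists x.
rewrite leNgt; apply/negP => lr.
have ll : dot l l = 1 by apply/esphereP.
pose ray := X `&` [set x | `|F x - dot l (F x) *: l| <= 0].
have rayP x : ray x <-> X x /\ F x = dot l (F x) *: l.
  rewrite /ray /= normr_le0 subr_eq0.
  by split => -[Xx /eqP].
have cray : compact ray.
  apply: compact_closedI => //; apply: closed_sublevel.
  exact: dist_to_line_continuous.
have rayz : ray z by apply/rayP; rewrite Fz dot0r scale0r.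
have [x /set_mem/rayP[Xx Fx] xmax] :=
  compact_EVT_max (ex_intro _ _ rayz) cray (continuous_subspaceT (cl l)).
set t := dot l (F x) in Fx xmax.
have t0 : 0 <= t.
  have := xmax z (mem_set rayz).
  by rewrite Fz dot0r.
have Xint : X° x.
  apply: contrapT => nint; have : boundary X x by split => //; exact: subset_closure.
  move=> /rhs_le; rewrite Fx enormZ_ge0// leNgt => /negP; apply.
  by apply: le_lt_trans lr; exact: lhs_ge.
have /nbhs_ballP[e /= e0 Fe] := interior_image n_gt0 X_compact F_cont F_inj Xint.
pose s := e / (`|l| + 1).
have s0 : 0 < s by rewrite divr_gt0// ltr_wpDl.
have [y Xy Fy] : (F @` X) ((t + s) *: l).
  apply: Fe; rewrite -ball_normE /= Fx -scalerBl opprD addNKr normrZ normrN gtr0_norm//.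
  by rewrite /s mulrAC ltr_pdivrMr ?ltr_wpDl// ltr_pM2l// ltrDl.
have yt : dot l (F y) = t + s by rewrite Fy dotZr ll mulr1.
have : ray y by apply/rayP; rewrite yt.
move=> /mem_set/xmax; rewrite yt; lra.
Qed.
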